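(* Let $\mu>0$ be fixed. If $f:[0,1]\to\mathbb{R}$ is bounded, then $$\lim_{n\to+\infty}\mathscr{L}_n f(x)=f(x)$$ for every $x\in[0,1]$ at which $f$ is continuous. Moreover, for every $f\in C([0,1])$, $$\lim_{n\to+\infty}\mathscr{L}_n f(x)=f(x)\quad\text{uniformly for } x\in[0,1].$$
   Context: Fix a real parameter $\mu>0$. Put $\ln_\mu(x):=\ln(1+\mu+x)$ for $x\in[0,1]$, and for $n\in\mathbb{N}$, $n\ge 1$, and $0\le k\le n$ put $p_{n,k}(y):=\binom{n}{k}y^k(1-y)^{n-k}$ and $$a_n(x):=\frac{\ln\left(1+\frac{x}{n(1+\mu)}\right)}{\ln\left(1+\frac{1}{n(1+\mu)}\right)},\qquad x\in[0,1].$$ For a bounded function $f:[0,1]\to\mathbb{R}$, define $$\mathscr{L}_n f(x)=\mathscr{L}_n(f,x):=\ln_\mu(x)\sum_{k=0}^n \frac{f(k/n)}{\ln_\mu(k/n)}\,p_{n,k}(a_n(x)),\qquad x\in[0,1].$$ *)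

(* Defs.v *)
From HB Require Import structures.
From mathcomp Require Import all_boot all_order all_algebra.
From mathcomp Require Import all_classical all_reals all_analysis.

Set Implicit Arguments.
Unset Strict Implicit.
Unset Printing Implicit Defensive.

Import Order.TTheory GRing.Theory Num.Theory.
Import numFieldNormedType.Exports.

Local Open Scope classical_set_scope.
Local Open Scope ring_scope.

(* A function on [0, 1] is represented by a total function R -> R, of which
   only the values on `[0, 1] matter: Lop evaluates f at the points k / n. *)

Definition lnmu (R : realType) (mu x : R) : R := ln (1 + mu + x).

Definition bernstein (R : realType) (n k : nat) (y : R) : R :=
  'C(n, k)%:R * y ^+ k * (1 - y) ^+ (n - k).

(* Meaningful for n >= 1; at n = 0 this is a junk value, as 0^-1 = 0. *)
Definition anode (R : realType) (mu : R) (n : nat) (x : R) : R :=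
  ln (1 + x / (n%:R * (1 + mu))) / ln (1 + 1 / (n%:R * (1 + mu))).

Definition Lop (R : realType) (mu : R) (n : nat) (f : R -> R) (x : R) : R :=
  lnmu mu x *
    \sum_(k < n.+1) f (k%:R / n%:R) / lnmu mu (k%:R / n%:R)
                    * bernstein n k (anode mu n x).

(* Main.v *)
(* With g := f / ln_mu, the operator is L_n f = ln_mu . (B_n g) o a_n, where B_n
   is the Bernstein operator. Since u / (1 + u) <= ln (1 + u) <= u, the nodes
   satisfy |a_n(x) - x| <= 1 / n, so the second moment about x of the binomial
   weights p_{n,k}(a_n(x)) is at most 2 / n, uniformly in x. Chebyshev's argument
   then bounds |L_n f(x) - f(x)| in terms of the modulus of continuity of g at x,
   which is uniform in x when f is continuous on [0, 1]. *)
Require Import Defs.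
From HB Require Import structures.
From mathcomp Require Import all_boot all_order all_algebra.
From mathcomp Require Import all_classical all_reals all_analysis.
From mathcomp Require Import ring lra.

Set Implicit Arguments.
Unset Strict Implicit.
Unset Printing Implicit Defensive.

Import Order.TTheory GRing.Theory Num.Theory.
Import numFieldNormedType.Exports.

Local Open Scope classical_set_scope.
Local Open Scope ring_scope.

(** * Moments of the Bernstein weights and the approximation estimate *)

Section Bernstein.
Variable R : realType.
Implicit Types (n k : nat) (x y : R).

Lemma bernstein_ge0 n k y : 0 <= y <= 1 -> 0 <= bernstein n k y.
Proof.
move=> /andP[y0 y1]; rewrite /bernstein !mulr_ge0 ?exprn_ge0 ?subr_ge0 //.
Qed.

Lemma sum_bernstein n y : \sum_(k < n.+1) bernstein n k y = 1.
Proof.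
rewrite -[RHS](expr1n R n) -[1 in RHS](subrK y) exprDn.
by apply: eq_bigr => k _; rewrite /bernstein -mulr_natl; ring.
Qed.

(* The recurrence [k 'C(n + 1, k) = (n + 1) 'C(n, k - 1)] shifts the index. *)
Lemma sum_bernstein_shift n y (F : nat -> R) :
  \sum_(k < n.+2) k%:R * F k * bernstein n.+1 k y =
  n.+1%:R * y * \sum_(k < n.+1) F k.+1 * bernstein n k y.
Proof.
rewrite big_ord_recl !mul0r add0r mulr_sumr; apply: eq_bigr => k _.
rewrite lift0 /bernstein subSS exprS.
have := congr1 (fun m => m%:R : R) (mul_bin_diag n.+1 k).
rewrite !natrM /= => e.
transitivity (k.+1%:R * 'C(n.+1, k.+1)%:R *
    (F k.+1 * y * y ^+ k * (1 - y) ^+ (n - k))).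
  by ring.
by rewrite -e; ring.
Qed.

Lemma sum_bernstein1 n y :
  \sum_(k < n.+1) k%:R * bernstein n k y = n%:R * y.
Proof.
case: n => [|n]; first by rewrite big_ord1 !mul0r.
transitivity (\sum_(k < n.+2) k%:R * 1 * bernstein n.+1 k y).
  by apply: eq_bigr => k _; rewrite mulr1.
rewrite (sum_bernstein_shift n y (fun=> 1)).
under eq_bigr do rewrite mul1r.
by rewrite sum_bernstein mulr1.
Qed.

(** Shifting with [F k = k] leaves the weights of degree one less summed against [k + 1], that is,
    their first moment plus their total mass. *)
Lemma sum_bernstein2 n y :
  \sum_(k < n.+1) k%:R ^+ 2 * bernstein n k y =
  n%:R * y * (n%:R * y + (1 - y)).
Proof.
case: n => [|n]; first by rewrite big_ord1 /= expr0n !mul0r.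
transitivity (\sum_(k < n.+2) k%:R * k%:R * bernstein n.+1 k y).
  by apply: eq_bigr => k _; rewrite expr2.
rewrite (sum_bernstein_shift n y (fun k => k%:R)).
under eq_bigr do rewrite -natr1 mulrDl mul1r.
by rewrite big_split /= sum_bernstein1 sum_bernstein -natr1; ring.
Qed.

(** Squared bias plus variance of a binomial mean: expanding the square reduces it to the moments of
    order 0, 1 and 2. *)
Lemma sum_bernstein_sqr_dist n x y : (0 < n)%N ->
  \sum_(k < n.+1) (k%:R / n%:R - x) ^+ 2 * bernstein n k y =
  (y - x) ^+ 2 + y * (1 - y) / n%:R.
Proof.
move=> n0; have n0R : n%:R != 0 :> R by rewrite pnatr_eq0 -lt0n.
transitivity (\sum_(k < n.+1) (n%:R ^- 2 * (k%:R ^+ 2 * bernstein n k y)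
    - 2 * x / n%:R * (k%:R * bernstein n k y) + x ^+ 2 * bernstein n k y)).
  by apply: eq_bigr => k _; field.
rewrite big_split sumrB /= -!mulr_sumr sum_bernstein sum_bernstein1.
by rewrite sum_bernstein2; field.
Qed.

(* Chebyshev's argument: where [|k / n - x| >= d], the increment of [g] is
   at most [2 M <= 2 M ((k / n - x) / d) ^ 2]. *)
Lemma bernstein_approx n (g : R -> R) x y e d M : (0 < n)%N ->
  0 <= y <= 1 -> 0 <= x <= 1 -> 0 <= e -> 0 < d ->
  (forall t, 0 <= t <= 1 -> `|g t| <= M) ->
  (forall t, 0 <= t <= 1 -> `|t - x| < d -> `|g t - g x| <= e) ->
  `|\sum_(k < n.+1) g (k%:R / n%:R) * bernstein n k y - g x| <=
  e + 2 * M / d ^+ 2 * ((y - x) ^+ 2 + y * (1 - y) / n%:R).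
Proof.
move=> n0 y01 x01 e0 d0 gM ge.
have M0 : 0 <= M by apply: le_trans (gM x x01).
(* The second moment, [g x] and [e] are all written as sums against the weights, so that the
   inequality can be checked term by term. *)
rewrite -(sum_bernstein_sqr_dist _ _ n0).
rewrite -[g x]mulr1 -[X in g x * X](sum_bernstein n y) mulr_sumr -sumrB.
rewrite -[e]mulr1 -[X in e * X](sum_bernstein n y) !mulr_sumr -big_split /=.
apply: le_trans (ler_norm_sum _ _ _) _; apply: ler_sum => k _.
rewrite -mulrBl [X in _ <= _ + X]mulrA -mulrDl normrM.
rewrite (ger0_norm (bernstein_ge0 _ _ y01)).
apply: ler_wpM2r; first exact: bernstein_ge0.
set t := k%:R / n%:R.
have t01 : 0 <= t <= 1.
  rewrite divr_ge0 //= ler_pdivrMr ?ltr0n // mul1r ler_nat.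
  by rewrite -ltnS ltn_ord.
have [td|dt] := ltP `|t - x| d.
  apply: (le_trans (ge _ t01 td)); rewrite lerDl.
  by rewrite mulr_ge0 ?sqr_ge0 // divr_ge0 ?sqr_ge0 // mulr_ge0.
apply: (@le_trans _ _ (2 * M)).
  apply: le_trans (ler_normB _ _) _.
  by rewrite mulr_natl mulr2n lerD ?gM.
rewrite -[leLHS]add0r lerD // -mulrA ler_peMr ?mulr_ge0 //.
rewrite mulrC ler_pdivlMr ?exprn_gt0 // mul1r -[leRHS]real_normK ?num_real //.
by rewrite ler_pXn2r // nnegrE ltW.
Qed.

End Bernstein.

(** * The nodes [anode] and the error of the operator *)

Section Operator.
Variables (R : realType) (mu : R).
Implicit Types (n : nat) (f : R -> R) (x : R).

Lemma ln1D_ge (u : R) : 0 <= u -> u / (1 + u) <= ln (1 + u).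
Proof.
move=> u0; have u1 : 0 < 1 + u by lra.
rewrite -[leRHS]opprK -lnV ?posrE //.
(* The lower bound is [ln (1 + v) <= v] at [v = - u / (1 + u)], because [1 + v] is the inverse of
   [1 + u]. *)
have e : (1 + u)^-1 = 1 + - (u / (1 + u)) by field; lra.
rewrite [X in - ln X]e lerNr; apply: le_ln1Dx.
by rewrite ltrN2 ltr_pdivrMr // mul1r; lra.
Qed.

(** For [h = 1 / (n (1 + mu))] the ratio is [anode mu n x]. The two bounds on [ln] place it between
    [x / (1 + x h)] and [x (1 + h)], and both differ from [x] by at most [h]. *)
Lemma ln1D_ratio (h x : R) : 0 < h -> 0 <= x <= 1 ->
  0 <= ln (1 + x * h) / ln (1 + h) <= 1 /\
  `|ln (1 + x * h) / ln (1 + h) - x| <= h.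
Proof.
move=> h0 /andP[x0 x1].
have xh0 : 0 <= x * h by rewrite mulr_ge0 // ltW.
have xhh : x * h <= h by rewrite ler_piMl // ltW.
have lh : 0 < ln (1 + h) by rewrite ln_gt0 //; lra.
split.
  rewrite divr_ge0 ?(ltW lh) ?ln_ge0 //=; last lra.
  by rewrite ler_pdivrMr // mul1r ler_ln ?posrE; lra.
have A := ln1D_ge (ltW h0); have B := ln1D_ge xh0.
have C : ln (1 + h) <= h by apply: le_ln1Dx; lra.
have D : ln (1 + x * h) <= x * h by apply: le_ln1Dx; lra.
rewrite ler_pdivrMr in A; last lra.
rewrite ler_pdivrMr in B; last lra.
rewrite ler_distl; apply/andP; split.
  rewrite ler_pdivlMr //.
  have : 0 <= ln (1 + x * h) by rewrite ln_ge0 //; lra.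
  nra.
rewrite ler_pdivrMr //; nra.
Qed.

Lemma anode_itv n x : 0 < mu -> (0 < n)%N -> 0 <= x <= 1 ->
  0 <= anode mu n x <= 1 /\ `|anode mu n x - x| <= n%:R^-1.
Proof.
move=> mu_gt0 n0 x01; have n0R : 0 < n%:R :> R by rewrite ltr0n.
have m0 : 0 < 1 + mu by lra.
have h0 : 0 < (n%:R * (1 + mu))^-1 by rewrite invr_gt0 mulr_gt0.
rewrite /anode mul1r; have [-> D] := ln1D_ratio h0 x01; split=> //.
apply: le_trans D _; rewrite lef_pV2 ?posrE ?mulr_gt0 // ler_peMr ?ltW //.
lra.
Qed.

Lemma lnmu_gt0 x : 0 < mu -> 0 <= x -> 0 < lnmu mu x.
Proof. by move=> mu_gt0 x0; rewrite /lnmu ln_gt0 //; lra. Qed.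

Lemma le_lnmu : 0 < mu -> {in `[0, 1] &, {homo lnmu mu : x y / x <= y}}.
Proof.
move=> mu_gt0 x y; rewrite !in_itv /= => /andP[x0 _] /andP[y0 _] xy.
by rewrite /lnmu ler_ln ?posrE; lra.
Qed.

(** Factoring out [lnmu mu x], which is at most [lnmu mu 1], leaves the Bernstein error of
    [f / lnmu] at the node. *)
Lemma Lop_dist n f x e d M :
  0 < mu -> (0 < n)%N -> 0 <= x <= 1 -> 0 <= e -> 0 < d ->
  (forall t, 0 <= t <= 1 -> `|f t / lnmu mu t| <= M) ->
  (forall t, 0 <= t <= 1 -> `|t - x| < d ->
     `|f t / lnmu mu t - f x / lnmu mu x| <= e) ->
  `|Lop mu n f x - f x| <= lnmu mu 1 * (e + 4 * M / d ^+ 2 / n%:R).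
Proof.
move=> mu_gt0 n0 x01 e0 d0 fM fe; have n0R : 0 < n%:R :> R by rewrite ltr0n.
have M0 : 0 <= M by apply: le_trans (fM x x01).
have [/[dup] a01 /andP[a0 a1] ax] := anode_itv mu_gt0 n0 x01.
have /andP[x0 x1] := x01; have lx0 := lnmu_gt0 mu_gt0 x0.
rewrite /Lop -[X in _ - X](mulfVK (lt0r_neq0 lx0)) [X in _ - X]mulrC -mulrBr.
rewrite normrM (gtr0_norm lx0).
apply: ler_pM; rewrite ?(ltW lx0) //.
  by apply: le_lnmu; rewrite ?in_itv /=; lra.
apply: le_trans (bernstein_approx n0 a01 x01 e0 d0 fM fe) _.
rewrite lerD2l.
(* One [1 / n] is for the squared bias, the other for the variance. *)
have -> : 4 * M / d ^+ 2 / n%:R = 2 * M / d ^+ 2 * (n%:R^-1 + n%:R^-1).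
  by field; rewrite !lt0r_neq0.
have inv1 : (n%:R^-1 : R) <= 1 by rewrite invf_le1 // ler1n.
apply: ler_wpM2l; first by rewrite !mulr_ge0 ?invr_ge0 ?sqr_ge0.
apply: lerD.
  (* As the distance from the node to [x] is at most [1 / n <= 1], its square is no larger than
     itself. *)
  rewrite -real_normK ?num_real //; apply: (le_trans _ ax).
  by rewrite expr2 ler_piMr // (le_trans ax).
rewrite ler_piMl ?invr_ge0 ?ltW //; nra.
Qed.

(** The threshold on [n] is chosen before [x] and depends only on [e], [M], [d] and [mu], so the
    lemma serves both pointwise and uniform convergence. *)
Lemma Lop_near f M e : 0 < mu -> 0 < e ->
  (forall t, 0 <= t <= 1 -> `|f t / lnmu mu t| <= M) ->
  forall d, 0 < d ->
  \forall n \near \oo, forall x, 0 <= x <= 1 ->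
  (forall t, 0 <= t <= 1 -> `|t - x| < d ->
     `|f t / lnmu mu t - f x / lnmu mu x| <= e / (2 * lnmu mu 1)) ->
  `|f x - Lop mu n f x| <= e.
Proof.
move=> mu_gt0 e0 fM d d0; have l0 := lnmu_gt0 mu_gt0 ler01.
have M0 : 0 <= M by apply: le_trans (fM 0 _); rewrite ?lexx ?ler01.
pose K := lnmu mu 1 * (4 * M / d ^+ 2).
have K0 : 0 <= K.
  by apply: mulr_ge0; [exact: ltW | rewrite !mulr_ge0 ?invr_ge0 ?sqr_ge0].
near=> n => x x01 fe.
have n0 : (0 < n)%N by near: n; exact: nbhs_infty_gt.
have n0R : 0 < n%:R :> R by rewrite ltr0n.
have Kn : K / n%:R <= e / 2.
  rewrite ler_pdivrMr // mulrC -ler_pdivrMr ?divr_gt0 //.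
  by near: n; exact: nbhs_infty_ger.
rewrite distrC.
apply: le_trans (Lop_dist mu_gt0 n0 x01 _ d0 fM fe) _.
  by rewrite divr_ge0 ?mulr_ge0 ?ltW.
have -> : lnmu mu 1 * (e / (2 * lnmu mu 1) + 4 * M / d ^+ 2 / n%:R) =
    e / 2 + K / n%:R.
  by rewrite /K; field; rewrite !lt0r_neq0.
lra.
Unshelve. all: by end_near. Qed.

Lemma bounded_div_lnmu f : 0 < mu -> [bounded f x | x in `[0, 1]%classic] ->
  exists M, forall t, 0 <= t <= 1 -> `|f t / lnmu mu t| <= M.
Proof.
move=> mu_gt0 /pinfty_ex_gt0[M _ fM].
(* On the interval, [lnmu mu] is smallest at 0, where it is still positive. *)
exists (M / lnmu mu 0) => t /[dup] t01 /andP[t0 t1].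
have lt0 := lnmu_gt0 mu_gt0 t0; have l0 := lnmu_gt0 mu_gt0 (lexx 0).
rewrite normrM normfV (gtr0_norm lt0); apply: ler_pM;
  rewrite ?invr_ge0 ?(ltW lt0)//.
  by apply: fM; rewrite /= in_itv.
by rewrite lef_pV2 ?posrE // le_lnmu // !in_itv /= ?lexx ?ler01.
Qed.

Lemma cvg_within_div_lnmu f x : 0 < mu -> 0 <= x <= 1 ->
  f @ within `[0, 1]%classic (nbhs x) --> f x ->
  (fun t => f t / lnmu mu t) @ within `[0, 1]%classic (nbhs x) -->
  f x / lnmu mu x.
Proof.
move=> mu_gt0 /andP[x0 x1] fx; apply: cvgM => //.
apply: cvgV; first by rewrite lt0r_neq0 ?lnmu_gt0.
apply: cvg_within_filter.
apply: (@continuous_comp _ _ _ (fun t : R => 1 + mu + t) (@ln R)).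
  by apply: cvgD; [exact: cvg_cst|exact: cvg_id].
by apply: continuous_ln; lra.
Qed.

End Operator.

(** * Uniform continuity on the unit interval *)

Lemma cvg_within_dist (R : realType) (g : R -> R) (x e : R) : 0 < e ->
  g @ within `[0, 1]%classic (nbhs x) --> g x ->
  exists2 d, 0 < d & forall t, 0 <= t <= 1 -> `|t - x| < d ->
    `|g t - g x| <= e.
Proof.
move=> e0 /cvgrPdist_le /(_ e e0) [d /= d0 gd]; exists d => // t t01 tx.
by rewrite distrC; apply: gd; rewrite /= ?in_itv // distrC.
Qed.

Lemma heine_cantor (R : realType) (g : R -> R) (e : R) : 0 < e ->
  (forall x : R, 0 <= x <= 1 -> g @ within `[0, 1]%classic (nbhs x) --> g x) ->
  exists2 d, 0 < d & forall x, 0 <= x <= 1 -> forall t, 0 <= t <= 1 ->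
    `|t - x| < d -> `|g t - g x| <= e.
Proof.
move=> e0 gc.
(* In near-covering form, compactness turns a property [P d y] that holds for [y] near each point
   and [d] small into one that holds for small [d] on the whole interval. *)
have /compact_near_coveringP cover := @segment_compact R 0 1.
pose P (d x : R) := 0 <= x <= 1 -> forall t, 0 <= t <= 1 ->
    `|t - x| < d -> `|g t - g x| <= e.
have : \forall d \near 0^'+, `[0, 1]%classic `<=` P d.
  apply: cover => x /=; rewrite in_itv /= => x01.
  have [r r0 gr] := cvg_within_dist (divr_gt0 e0 (ltr0Sn R 1)) (gc x x01).
  (* Two halves of [r] keep both [y] and [t] within [r] of [x], where [g] stays within [e / 2] of
     [g x]. *)
  exists (ball x (r / 2), [set d | d <= r / 2]) => /=.
    split; first by apply: nbhsx_ballx; rewrite divr_gt0.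
    by apply: nbhs_right_le; rewrite divr_gt0.
  move=> [y d] /= [xy dr] y01 t t01 ty.
  rewrite /ball /= in xy.
  have yr : `|y - x| < r by rewrite distrC; lra.
  have tr : `|t - x| < r.
    by apply: le_lt_trans (ler_distD y _ _) _; rewrite (distrC y); lra.
  apply: le_trans (ler_distD (g x) _ _) _.
  by have := gr t t01 tr; have := gr y y01 yr; rewrite (distrC (g x)); lra.
move=> H; have : \forall d \near 0^'+, 0 < d /\ `[0, 1]%classic `<=` P d.
  by near=> d; split; near: d => //; exact: nbhs_right_gt.
move=> /filter_ex[d [d0 Pd]]; exists d => // x x01.
by apply: Pd => //=; rewrite in_itv.
Unshelve. all: by end_near. Qed.

Theorem theorem3p1 (R : realType) (mu : R) (mu_gt0 : 0 < mu) :
  (forall f : R -> R,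
     [bounded f x | x in `[0, 1]%classic] ->
     forall x : R, x \in `[0, 1] ->
       f @ within `[0, 1]%classic (nbhs x) --> f x ->
       Lop mu n f x @[n --> \oo] --> f x)
  /\
  (forall f : R -> R,
     {within `[0, 1], continuous f} ->
     {uniform `[0, 1], (fun n => Lop mu n f) @ \oo --> f}).
Proof.
have half e : 0 < e -> 0 < e / (2 * lnmu mu 1).
  by move=> e0; rewrite divr_gt0 // mulr_gt0 // lnmu_gt0.
split=> f.
  move=> /(bounded_div_lnmu mu_gt0)[M fM] x; rewrite in_itv /= => x01 fx.
  apply/cvgrPdist_le => e e0.
  have [d d0 fd] :=
    cvg_within_dist (half e e0) (cvg_within_div_lnmu mu_gt0 x01 fx).
  by apply: filterS (Lop_near mu_gt0 e0 fM d0) => n; apply.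
move=> /[dup] fcont /subspace_continuousP fc.
have /(bounded_div_lnmu mu_gt0)[M fM] : [bounded f x | x in `[0, 1]%classic].
  have /compact_bounded[B [_ fB]] :=
    continuous_compact fcont (@segment_compact R 0 1).
  exists B; split; first exact: num_real.
  by move=> C BC x x01 /=; apply: (fB C BC); exists x.
move=> U /uniform_nbhs[E []]; rewrite -entourage_ballE => -[e /= e0 eE] fU.
(* Balls are open while [Lop_near] gives a large inequality; halving [e] makes it strict. *)
have e20 : 0 < e / 2 by rewrite divr_gt0.
have [|d d0 fd] :=
    @heine_cantor R (fun t => f t / lnmu mu t) _ (half _ e20).
  move=> x x01; apply: cvg_within_div_lnmu => //; apply: fc.
  by rewrite /= in_itv.
apply: filterS (Lop_near mu_gt0 e20 fM d0) => n Ln.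
apply: fU => x; rewrite /= in_itv /= => x01; apply: eE; rewrite /= /ball /=.
by apply: le_lt_trans (Ln x x01 (fd x x01)) _; lra.
Qed.
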